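(* Let $n\ge 1$ and let $G$ be a complete $n$-partite graph (parts of arbitrary sizes) such that at least $\lfloor \frac{n-1}{2}\rfloor$ of its parts have size greater than one. Then $\chi^{e}(G)=2$.
   Context: All graphs are simple and undirected. A graph is nice if it has no connected component isomorphic to $K_2$. For a nice graph $G$ and an edge weighting $w:E(G)\to\{1,\dots,k\}$, put $\sigma^{e}(v)=\sum_{e\ni v} w(e)$ for each vertex $v$. The weighting is neighbor sum distinguishing if $\sigma^{e}(u)\neq\sigma^{e}(v)$ for every edge $uv$. $\chi^{e}(G)$ is the minimum $k$ for which such a weighting exists. A complete $n$-partite graph has its vertex set partitioned into $n$ nonempty parts, with two vertices adjacent iff they lie in different parts.
   Formalization: The value 2 is claimed only when two distinct parts have equal size; if all part sizes are distinct (e.g. K_{1,2}), all-ones weights work and the value is shown to be 1, so the printed claim fails there. G is assumed nice. *)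

(* Defs.v *)
From mathcomp Require Import all_boot.

Set Implicit Arguments.
Unset Strict Implicit.
Unset Printing Implicit Defensive.

Record sgraph := SGraph {
  vertex :> finType;
  adj : rel vertex;
  adj_sym : symmetric adj;
  adj_irrefl : irreflexive adj }.

Arguments adj {s}.

Section Graph.
Variable G : sgraph.

Definition edges : {set {set G}} :=
  [set e | [exists u, exists v, adj u v && (e == [set u; v])]].

Definition component (x : G) : {set G} := [set y | connect adj x y].

Definition induces_complete (m : nat) (A : {set G}) : Prop :=
  exists f : 'I_m -> G,
    [/\ injective f, [set f i | i : 'I_m] = A
      & forall i j, adj (f i) (f j) = (i != j)].

Definition nice : Prop := forall x : G, ~ induces_complete 2 (component x).

(* Values of w outside [edges] are never used. *)
Definition weighting (k : nat) (w : {set G} -> nat) : Prop :=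
  forall e, e \in edges -> 1 <= w e <= k.

Definition vsum (w : {set G} -> nat) (v : G) : nat :=
  \sum_(e in edges | v \in e) w e.

Definition neighbor_sum_distinguishing (w : {set G} -> nat) : Prop :=
  forall u v : G, adj u v -> vsum w u <> vsum w v.

Definition nsd_weightable (k : nat) : Prop :=
  exists w, weighting k w /\ neighbor_sum_distinguishing w.

(* "chi^e(G) = k", as a relation because the minimum need not exist when G is
   not nice.  Only k >= 1 is considered, so an edgeless graph has value 1. *)
Definition chi_e_is (k : nat) : Prop :=
  [/\ 0 < k, nsd_weightable k
    & forall j, 0 < j -> nsd_weightable j -> k <= j].

(* [partition] already requires the parts to be nonempty. *)
Definition complete_multipartite (n : nat) (P : {set {set G}}) : Prop :=
  [/\ partition P [set: G], #|P| = n
    & forall u v : G, adj u v = (pblock P u != pblock P v)].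

End Graph.

(* Main.v *)
(* The sum of v under a weighting by {1, 2} is deg v + deg_H v, where H is the
   graph of the edges of weight 2. Rank the parts 0, ..., n-1 by decreasing
   sizes a_0 >= a_1 >= ..., let k = (n-1)/2 rounded down, and join the parts p
   and q in H iff p + q > 2k. The sum is then constant on each part and strictly
   increases with the rank, except that the parts k and k+1 tie when
   a_k = a_(k+1). In that case the gaps below part k and above part k+1 are at
   least a_(k-1), hence at least 2 by the hypothesis on the parts, so adding to H
   a matching of part k+1 into part k-1 (not joined in H, as their ranks add up
   to 2k) breaks the tie. If k = 0, the tied graph is K_(m,m) with m >= 2, and
   H is the star of all edges at one vertex. *)
Require Import Defs.
From mathcomp Require Import all_boot.
From mathcomp Require Import zify.

Set Implicit Arguments.
Unset Strict Implicit.
Unset Printing Implicit Defensive.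

(** * Sums under weights 1 and 2 as degree counts *)

Lemma cards_orb (T : finType) (p q e : pred T) :
  (forall x, e x = p x || q x) -> (forall x, ~~ (p x && q x)) ->
  #|[set x | e x]| = #|[set x | p x]| + #|[set x | q x]|.
Proof.
move=> eE pq; rewrite -cardsUI [_ :&: _](_ : _ = set0) ?cards0 ?addn0.
  by apply: eq_card => x; rewrite !inE.
by apply/setP => x; rewrite !inE; apply/negbTE.
Qed.

Lemma vsum_adj (G : sgraph) (w : {set G} -> nat) (v : G) :
  vsum w v = \sum_(u | adj v u) w [set v; u].
Proof.
rewrite /vsum -(big_imset w (h := fun u => [set v; u]) (A := [pred u | adj v u])) /=.
  apply: eq_bigl => e; apply/andP/imsetP => [[]|[u]].
    rewrite inE => /existsP[x /existsP[y /andP[xy /eqP->]]].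
    rewrite !inE => /orP[]/eqP->; first by exists y.
    by exists x; rewrite ?inE 1?adj_sym // setUC.
  rewrite inE => vu ->; rewrite !inE eqxx; split=> //.
  by apply/existsP; exists v; apply/existsP; exists u; rewrite vu eqxx.
move=> x y; rewrite !inE => vx vy /setP /(_ x).
rewrite !inE eqxx orbT => /esym/orP[]/eqP // xv.
by rewrite xv adj_irrefl in vx.
Qed.

Lemma edge_adj (G : sgraph) (u v : G) : adj u v -> [set u; v] \in edges G.
Proof.
by move=> uv; rewrite inE; apply/existsP; exists u; apply/existsP; exists v; rewrite uv eqxx.
Qed.

Lemma vsum_weighting1 (G : sgraph) (w : {set G} -> nat) (v : G) :
  weighting 1 w -> vsum w v = #|[set u | adj v u]|.
Proof.
move=> w1; rewrite vsum_adj -sum1dep_card; apply: eq_bigr => u vu.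
by have := w1 _ (edge_adj vu); lia.
Qed.

Lemma nsd_weightable2 (G : sgraph) (h : rel G) :
  symmetric h -> subrel h adj ->
  (forall u v, adj u v ->
     #|[set x | adj u x]| + #|[set x | h u x]| <>
     #|[set x | adj v x]| + #|[set x | h v x]|) ->
  nsd_weightable G 2.
Proof.
move=> hC hadj hN.
(* The quantifiers also allow x = y, which is harmless since [h] inherits irreflexivity from
   [adj]. *)
pose w (e : {set G}) := 1 + [exists x in e, exists y in e, h x y].
have hxx x : h x x = false by apply/negP => /hadj; rewrite adj_irrefl.
have wE u v : w [set u; v] = 1 + h u v.
  congr (1 + nat_of_bool _); apply/existsP/idP => [[x /andP[]]|huv].
    rewrite !inE => xuv /existsP[y]; rewrite !inE.
    by case/orP: xuv => /eqP-> /andP[/orP[]/eqP->]; rewrite ?hxx // hC.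
  exists u; rewrite !inE eqxx; apply/existsP; exists v.
  by rewrite !inE eqxx orbT.
have sumE v : vsum w v = #|[set x | adj v x]| + #|[set x | h v x]|.
  rewrite vsum_adj (eq_bigr _ (fun u _ => wE v u)) big_split /= sum1dep_card.
  congr (_ + _); rewrite -big_mkcondr /= sum1dep_card.
  by apply: eq_card => x; rewrite !inE; apply: andb_idl; apply: hadj.
exists w; split=> [e _|u v uv]; first by rewrite /w; case: [exists _ in _, _].
by rewrite !sumE; apply: hN.
Qed.

(** * Graphs whose parts are ranked by decreasing size *)

Section Ranked.
Variables (G : sgraph) (n : nat) (r : G -> nat).
Hypothesis adjE : forall u v : G, adj u v = (r u != r v).
Let a p := #|[set v | r v == p]|.
Hypothesis a_gt0 : forall p, (0 < a p) = (p < n).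
Hypothesis a_anti : forall p, a p.+1 <= a p.

Lemma rank_lt v : r v < n.
Proof. by rewrite -a_gt0; apply/card_gt0P; exists v; rewrite inE. Qed.

Lemma card_adj v : #|[set u | adj v u]| + a (r v) = #|G|.
Proof.
rewrite addnC -(cardsC [set u | r u == r v]); congr (_ + _).
by apply: eq_card => u; rewrite !inE adjE eq_sym.
Qed.

Let k := (n - 1) %/ 2.
Let S p := #|[set u | 2 * k < p + r u]|.

(** Raising p by one newly counts exactly the vertices of rank 2k - p; the bound on p keeps this
    subtraction exact. *)
Lemma S_succ p : p <= 2 * k -> S p.+1 = S p + a (2 * k - p).
Proof.
by move=> pk; apply: cards_orb => u; lia.
Qed.

(* A part of rank p has weighted degree |G| + S p - c p: the threshold graph
   p + q > 2k counts the part itself when p > k. *)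
Let c p := a p + if k < p then a p else 0.

Lemma c_low p : p <= k -> c p = a p.
Proof. by rewrite /c ltnNge => ->; rewrite addn0. Qed.

Lemma c_high p : k < p -> c p = a p + a p.
Proof. by rewrite /c => ->. Qed.

(** [m] is a correction added to the threshold graph; living on rank sum 2k, it is disjoint from it.
    The last hypothesis compares the largest possible sum at rank p with the smallest at rank p + 1,
    with the [c] terms moved across to avoid subtraction. *)
Lemma nsd_threshold (m : rel G) (lo hi : nat -> nat) :
    symmetric m ->
    (forall u v, m u v -> (r u != r v) && (r u + r v == 2 * k)) ->
    (forall v, lo (r v) <= #|[set u | m v u]| <= hi (r v)) ->
    (forall p, p.+1 < n -> S p + hi p + c p.+1 < S p.+1 + lo p.+1 + c p) ->
  nsd_weightable G 2.
Proof.
move=> mC mP mB gap.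
pose h u v := (r u != r v) && (2 * k < r u + r v) || m u v.
have hC : symmetric h by move=> u v; rewrite /h eq_sym addnC mC.
have hadj : subrel h adj.
  by move=> u v; rewrite adjE => /orP[/andP[]|/mP/andP[]].
have hE v : #|[set u | h v u]| + (if k < r v then a (r v) else 0) = S (r v) + #|[set u | m v u]|.
  have -> : #|[set u | h v u]| = #|[set u | (r v != r u) && (2 * k < r v + r u)]|
                               + #|[set u | m v u]|.
    by apply: cards_orb => u //; apply/negP => /andP[? /mP]; lia.
  have -> : S (r v) = #|[set u | (r v != r u) && (2 * k < r v + r u)]|
                      + (if k < r v then a (r v) else 0).
    rewrite /S -(cardsID [set u | r u == r v]) addnC; congr (_ + _).
      by apply: eq_card => u; rewrite !inE eq_sym.
    case: ltnP => kv.
      by apply: eq_card => u; rewrite !inE; lia.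
    by apply/eqP; rewrite cards_eq0; apply/eqP/setP => u; rewrite !inE; lia.
  lia.
(* Consecutive gaps telescope because [lo] is at most [hi] at each intermediate rank, which a vertex
   of that rank witnesses. *)
have chain p q : p < q -> q < n -> S p + hi p + c q < S q + lo q + c p.
  elim: q => // q IH; rewrite ltnS leq_eqVlt => /orP[/eqP->|pq] qn; first exact: gap.
  have [v rv] : exists v, r v = q.
    have /card_gt0P[v] : 0 < a q by rewrite a_gt0 ltnW.
    by rewrite inE => /eqP <-; exists v.
  have := mB v; rewrite rv.
  by have := IH pq (ltnW qn); have := gap _ qn; lia.
apply: (nsd_weightable2 hC hadj) => u v; rewrite adjE.
have := hE u; have := hE v; have := card_adj u; have := card_adj v.
have := mB u; have := mB v; rewrite /c in chain.
case: (ltngtP (r u) (r v)) => [uv|vu|//].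
  by have := chain _ _ uv (rank_lt v); lia.
by have := chain _ _ vu (rank_lt u); lia.
Qed.

Lemma nsd_strict : a k.+1 < a k -> nsd_weightable G 2.
Proof.
move=> ak; apply: (@nsd_threshold (fun _ _ => false) (fun=> 0) (fun=> 0)) => // [v|p pn].
  by rewrite cards0 // eq_card0 // => u; rewrite inE.
have pk : p <= 2 * k by rewrite /k; lia.
have a2kp : 0 < a (2 * k - p) by rewrite a_gt0 /k; lia.
have ap := a_anti p; rewrite S_succ //; case: (ltngtP p k) => [pk'|pk'|->].
- by rewrite !c_low; lia.
- by rewrite !c_high; lia.
- by rewrite (c_low (leqnn k)) (c_high (ltnSn k)) mul2n -addnn addnK; lia.
Qed.

Lemma nsd_matching : 0 < k -> 1 < a k.-1 -> a k.+1 = a k -> nsd_weightable G 2.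
Proof.
move=> k0 ak1 ak.
pose A := [set v | r v == k.+1]; pose B := [set v | r v == k.-1].
have AB : #|A| <= #|B|.
  by have := a_anti k.-1; rewrite prednK // -ak.
(* Match by position in the enumerations; since A is no larger than B, the default is never reached
   on A. *)
pose g x := nth x (enum B) (index x (enum A)).
have gB x : x \in A -> g x \in B.
  by move=> xA; rewrite -mem_enum mem_nth // -cardE (leq_trans _ AB) // cardE index_mem mem_enum.
have gI : {in A &, injective g}.
  move=> x y xA yA; rewrite /g (set_nth_default y).
    move/eqP; rewrite nth_uniq ?enum_uniq //.
    - by move/eqP/index_inj => -> //; rewrite mem_enum.
    - by rewrite -cardE (leq_trans _ AB) // cardE index_mem mem_enum.
    - by rewrite -cardE (leq_trans _ AB) // cardE index_mem mem_enum.
  by rewrite -cardE (leq_trans _ AB) // cardE index_mem mem_enum.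
pose m u v := (u \in A) && (v == g u) || (v \in A) && (u == g v).
have rA x : x \in A -> r x = k.+1 by rewrite inE => /eqP.
have rB x : x \in A -> r (g x) = k.-1 by move/gB; rewrite inE => /eqP.
(* Every vertex of part k+1 is matched, but possibly only some of part k-1, so there the bounds are
   0 and 1. *)
apply: (@nsd_threshold m (fun p => p == k.+1) (fun p => (p == k.+1) + (p == k.-1))).
- by move=> u v; rewrite /m orbC.
- by move=> u v /orP[]/andP[xA /eqP->]; rewrite (rA _ xA) (rB _ xA); lia.
- move=> v; case: (boolP (v \in A)) => vA.
    have -> : [set u | m v u] = [set g v].
      apply/setP => u; rewrite in_set in_set1 /m vA /=; apply: orb_idr => /andP[uA /eqP vg].
      by have := rA _ vA; rewrite vg (rB _ uA); lia.
    by rewrite cards1 rA // eqxx; lia.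
  have -> : r v == k.+1 = false by move: vA; rewrite inE => /negbTE.
  rewrite /= add0n /m (negbTE vA) /=.
  have [[u /andP[uA /eqP vu]]|no] :=
      altP (@existsP G (fun u => (u \in A) && (v == g u))).
    rewrite vu rB // eqxx (_ : [set _ | _] = [set u]) ?cards1 //.
    apply/setP => x; rewrite !inE; apply/andP/eqP => [[xA /eqP/gI->]|->] //.
      by rewrite inE.
    by move: uA; rewrite inE => ->.
  rewrite (_ : [set _ | _] = set0) ?cards0 //.
  by apply/setP => x; rewrite !inE; apply: contraNF no => H; apply/existsP; exists x; rewrite inE.
- move=> p pn.
  have pk : p <= 2 * k by rewrite /k; lia.
  have a2kp : 0 < a (2 * k - p) by rewrite a_gt0 /k; lia.
  have ap := a_anti p; rewrite S_succ //.
  (* The matching opens the gap at p = k and costs at most 1 at p = k-1 and p = k+1, where the gap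
     was at least a(k-1) > 1. *)
  have [pE|pk1] := eqVneq p k.-1.
    have pS : p.+1 = k by rewrite pE prednK.
    have p2 : 2 * k - p = k.+1 by lia.
    by move: ap ak1; rewrite -pE p2 pS !c_low; lia.
  have [pE|pk2] := eqVneq p k.
    by rewrite pE (c_low (leqnn k)) (c_high (ltnSn k)) mul2n -addnn addnK; lia.
  have [pE|pk3] := eqVneq p k.+1.
    have p2 : 2 * k - p = k.-1 by lia.
    by rewrite p2 !c_high; lia.
  by case: (ltnP k p) => kp; [rewrite !c_high | rewrite !c_low]; lia.
Qed.

(** With m = a(0) and the star centred at [z] in part 1, the sums are m + 1 on part 0, 2m at [z] and
    m on the rest of part 1. *)
Lemma nsd_balanced_bipartite : n = 2 -> 1 < a 0 -> a 1 = a 0 -> nsd_weightable G 2.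
Proof.
move=> n2 a0 a1.
have /card_gt0P[z] : 0 < a 1 by rewrite a_gt0 n2.
rewrite inE => /eqP rz.
have r01 v : (r v == 0) || (r v == 1) by have := rank_lt v; rewrite n2; lia.
pose h u v := (u == z) && (r v == 0) || (v == z) && (r u == 0).
apply: (@nsd_weightable2 G h) => [u v|u v|].
- by rewrite /h orbC.
- by rewrite adjE => /orP[]/andP[/eqP-> /eqP->]; rewrite rz.
have h0 v : r v = 0 -> #|[set u | h v u]| = 1.
  move=> rv; rewrite -(cards1 z); apply: eq_card => u; rewrite !inE /h rv eqxx andbT.
  by case: eqP rv => //= ->; rewrite rz.
have h1 v : r v = 1 -> #|[set u | h v u]| = (v == z) * a 0.
  move=> rv; case: eqP => [->|/eqP/negbTE vz]; rewrite ?mul1n ?mul0n.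
    by apply: eq_card => u; rewrite !inE /h eqxx rz andbF orbF.
  by apply/eqP; rewrite cards_eq0; apply/eqP/setP => u; rewrite !inE /h vz rv andbF.
move=> u v; rewrite adjE; have := card_adj u; have := card_adj v.
have := r01 u; have := r01 v.
move=> /orP[]/eqP rv /orP[]/eqP ru; rewrite ru rv ?(h0 _ ru) ?(h0 _ rv) ?(h1 _ ru) ?(h1 _ rv) //.
  by case: (u == z); lia.
by case: (v == z); lia.
Qed.

Lemma nsd_ranked : 0 < n -> (n = 2 -> 1 < a 0) -> (0 < k -> 1 < a k.-1) ->
  nsd_weightable G 2.
Proof.
move=> n0 n2 ak1; have := a_anti k; rewrite leq_eqVlt => /orP[/eqP ak|]; last exact: nsd_strict.
case: (posnP k) => k0; last exact: nsd_matching (ak1 k0) ak.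
(* The tie rules out n = 1, where a(1) = 0 < a(0). *)
have n1 : 1 < n by have : 0 < a k.+1; [rewrite ak a_gt0 k0 | rewrite a_gt0 k0].
have nE : n = 2 by move: k0; rewrite /k; lia.
by apply: nsd_balanced_bipartite; rewrite ?n2 //; rewrite k0 in ak.
Qed.

Lemma nice_K2 : nice G -> n = 2 -> 1 < a 0.
Proof.
move=> nG n2; have : 0 < a 0 by rewrite a_gt0 n2.
rewrite leq_eqVlt => /orP[/eqP/esym a0|//]; exfalso.
have : a 1 = 1 by have := a_anti 0; have := a_gt0 1; rewrite a0 n2; lia.
move: a0 => /eqP/cards1P[x /setP xP] /eqP/cards1P[y /setP yP].
have rx : r x = 0 by have := xP x; rewrite !inE eqxx => /eqP.
have ry : r y = 1 by have := yP y; rewrite !inE eqxx => /eqP.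
pose f (i : 'I_2) := if val i == 0 then x else y.
have rf i : r (f i) = val i by rewrite /f; case: i => [[|[|i]] //].
apply: (nG x); exists f; split.
- by move=> i j /(congr1 r); rewrite !rf => /val_inj.
- apply/setP => v; rewrite inE; transitivity true; last first.
    have := rank_lt v; rewrite n2 ltnS leq_eqVlt ltnS leqn0 orbC => /orP[] rv; apply/esym.
      by have := xP v; rewrite !inE rv => /esym/eqP->; apply: connect0.
    have := yP v; rewrite !inE rv => /esym/eqP->.
    by apply: connect1; rewrite adjE rx ry.
  apply/imsetP; have := rank_lt v; rewrite n2 => v2; exists (Ordinal v2) => //.
  have := xP v; have := yP v; rewrite !inE /f /=.
  by move: v2; case: (r v) => [|[|]] //= _ => [_ /esym/eqP|/esym/eqP].
- by move=> i j; rewrite adjE !rf.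
Qed.

End Ranked.

(** * Ranking the parts, and the theorem *)

Lemma multipartite_rank (G : sgraph) (n : nat) (P : {set {set G}}) :
  complete_multipartite n P ->
  exists r : G -> nat,
    [/\ forall u v : G, adj u v = (r u != r v),
        forall p, (0 < #|[set v | r v == p]|) = (p < n),
        forall p, #|[set v | r v == p.+1]| <= #|[set v | r v == p]|
      & forall p, p < #|[set A in P | 1 < #|A|]| -> 1 < #|[set v | r v == p]|].
Proof.
move=> [/and3P[/eqP covP tiP nP0] cardP adjE].
pose ge (A B : {set G}) := #|B| <= #|A|.
pose s := sort ge (enum P).
have sP A : (A \in s) = (A \in P) by rewrite mem_sort mem_enum.
have ss : size s = n by rewrite size_sort -cardE.
have us : uniq s by rewrite sort_uniq enum_uniq.
have ge_trans : transitive ge by move=> B A C AB BC; apply: leq_trans BC AB.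
have sorted_s : sorted ge s by apply: sort_sorted => A B; apply: leq_total.
have bP v : pblock P v \in P by rewrite pblock_mem // covP inE.
pose r v := index (pblock P v) s.
have rn v : r v < n by have := index_mem (pblock P v) s; rewrite sP bP ss.
have level p : p < n -> [set v | r v == p] = nth set0 s p.
  move=> pn; have pP : nth set0 s p \in P by rewrite -sP mem_nth ?ss.
  apply/setP => v; rewrite inE; apply/eqP/idP => [<-|vp].
    by rewrite nth_index ?sP // mem_pblock covP inE.
  by rewrite /r (def_pblock tiP pP vp) index_uniq ?ss.
have level0 p : n <= p -> [set v | r v == p] = set0.
  move=> np; apply/setP => v; rewrite !inE; apply/negbTE.
  by rewrite neq_ltn (leq_trans (rn v) np).
have anti p q : p <= q -> #|[set v | r v == q]| <= #|[set v | r v == p]|.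
  case: (ltnP q n) => [qn pq|/level0 ->]; last by rewrite cards0.
  have pn := leq_ltn_trans pq qn; rewrite !level //.
  by apply: (sorted_leq_nth ge_trans) sorted_s _ _ _ _ pq; rewrite ?inE ?ss // => A; apply: leqnn.
exists r; split=> //.
- move=> u v; rewrite adjE /r; congr negb.
  apply/eqP/eqP => [->//|uv]; have uP : pblock P u \in s by rewrite sP.
  by rewrite -(nth_index set0 uP) uv nth_index // sP.
- move=> p; case: (ltnP p n) => pn; last by rewrite level0 ?cards0.
  rewrite level // lt0n cards_eq0; apply: contraNneq nP0 => <-.
  by rewrite -sP mem_nth ?ss.
- by move=> p; apply: anti.
(* If part p has at most one vertex, so has every later part; hence the large parts are among the
   first p. *)
move=> p; rewrite ltnNge; apply: contraR; rewrite -leqNgt => ap.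
have sub : [set A in P | 1 < #|A|] \subset take p s.
  apply/subsetP => A; rewrite inE -sP => /andP[As A1].
  have ip : index A s < n by rewrite -ss index_mem.
  rewrite -(nth_index set0 As) in_take ?mem_nth ?ss // nth_index //.
  rewrite ltnNge; apply: contraL A1 => /anti; rewrite level // nth_index //.
  by rewrite -leqNgt => /leq_trans; apply.
apply: leq_trans (subset_leq_card sub) _.
by apply: leq_trans (card_size _) _; rewrite size_take_min geq_minl.
Qed.

Lemma card_adj_multipartite (G : sgraph) (n : nat) (P : {set {set G}}) (v : G) :
  complete_multipartite n P -> #|[set u | adj v u]| + #|pblock P v| = #|G|.
Proof.
move=> [/and3P[/eqP covP tiP _] _ adjE].
rewrite addnC -(cardsC (pblock P v)); congr (_ + _); apply: eq_card => u.
by rewrite !inE adjE eq_pblock // covP inE.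
Qed.

(** Under constant weight 1 the sum of v is |G| minus the size of its part, which separates
    neighbors exactly when the part sizes are pairwise distinct. Hence the two cases: value 2 with a
    repeated size, value 1 otherwise. *)
Theorem theorem2p1 (G : sgraph) (n : nat) (P : {set {set G}}) :
  1 <= n ->
  nice G ->
  complete_multipartite n P ->
  (n - 1) %/ 2 <= #|[set A in P | 1 < #|A|]| ->
  ((exists A B : {set G}, [/\ A \in P, B \in P, A != B & #|A| = #|B|]) ->
     chi_e_is G 2) /\
  ({in P &, injective (fun A : {set G} => #|A|)} -> chi_e_is G 1).
Proof.
move=> n1 nG cP kP; have [/and3P[/eqP covP tiP nP0] _ adjE] := cP; split.
  move=> [A [B [AP BP AB cAB]]]; split=> //.
    have [r [rE r0 ra rb]] := multipartite_rank cP.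
    apply: (nsd_ranked rE r0 ra n1 (nice_K2 rE r0 ra nG)) => k0.
    by apply: rb; apply: leq_trans kP; rewrite prednK.
  (* For j = 1, vertices of two equal-sized parts are adjacent and have equal degree. *)
  move=> [|[|j]] // _ [w [w1 /= wN]]; exfalso.
  have ex C : C \in P -> exists2 x, x \in C & pblock P x = C.
    move=> CP; have /set0Pn[x xC] : C != set0 by apply: contraNneq nP0 => <-.
    by exists x => //; apply: def_pblock.
  have [[x _ xA] [y _ yB]] := (ex A AP, ex B BP).
  apply: (wN x y); first by rewrite adjE xA yB.
  rewrite !vsum_weighting1 //; apply/eqP; rewrite -(eqn_add2r #|A|) {2}cAB -xA -yB.
  by rewrite !(card_adj_multipartite _ cP).
move=> inj; split=> //; exists (fun=> 1); split=> // u v uv.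
have w1 : @weighting G 1 (fun=> 1) by [].
have bP x : pblock P x \in P by rewrite pblock_mem // covP inE.
rewrite !vsum_weighting1 // => E; move: uv; rewrite adjE => /eqP; apply.
apply: inj => //; have := card_adj_multipartite u cP.
by rewrite -(card_adj_multipartite v cP) E => /addnI.
Qed.
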